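(* Let $n>1$ and let $Y_1,\dots,Y_{n+1}$ follow the straight line regression model $Y_i=\beta_1+\beta_2h_i+\varepsilon_i$ with $E(\varepsilon_i)=0$. Suppose the random variables $Y_i$, $i=1,\dots,n+1$, are uncorrelated with non-increasing variances $\sigma_1^2\ge\sigma_2^2\ge\dots\ge\sigma_{n+1}^2$, and the explanatory variable takes two distinct real values $b\ne c$, alternating: $$h_i=\begin{cases}b&\text{if } i\text{ is odd},\\ c&\text{if } i\text{ is even}.\end{cases}$$ Then the ordinary least squares estimators of the intercept $\beta_1$ and the slope $\beta_2$ have the variance reduction property: $$V_{11}(i,i)\le V_{00}(i,i)\qquad\text{for } i\in\{1,2\}.$$
   Context: $A_1$ is the $(n+1)\times2$ design matrix whose $i$-th row is $(1,h_i)$, and $A_0$ is the $n\times 2$ matrix consisting of its first $n$ rows. $A_{00}=A_0^TA_0$, $A_{11}=A_1^TA_1$, $\mathbf{\Sigma}_{11}=\mathrm{Diag}\{\sigma_1^2,\dots,\sigma_{n+1}^2\}$, $\mathbf{\Sigma}_{00}=\mathrm{Diag}\{\sigma_1^2,\dots,\sigma_n^2\}$. The ordinary least squares (OLS) estimators of $\beta=(\beta_1,\beta_2)^T$ based on the first $n$ and on all $n+1$ observations are $\hat\beta_0=A_{00}^{-1}A_0^T(Y_1,\dots,Y_n)^T$ and $\hat\beta_1=A_{11}^{-1}A_1^T(Y_1,\dots,Y_{n+1})^T$; their covariance matrices are $$V_{00}=A_{00}^{-1}A_0^T\mathbf{\Sigma}_{00}A_0A_{00}^{-1},\qquad V_{11}=A_{11}^{-1}A_1^T\mathbf{\Sigma}_{11}A_1A_{11}^{-1}.$$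 *)

(* Defs.v *)
(* MathComp / MathComp-Analysis *)
From HB Require Import structures.
From mathcomp Require Import all_boot all_order all_algebra.
From mathcomp Require Import all_classical all_reals all_analysis.

Set Implicit Arguments.
Unset Strict Implicit.
Unset Printing Implicit Defensive.

Import Order.TTheory GRing.Theory Num.Theory.
Local Open Scope ring_scope.

(* Parameter index 0 is the intercept, 1 is the slope. *)
Definition design_mx (R : realType) (m : nat) (h : 'I_m -> R) : 'M[R]_(m, 2) :=
  \matrix_(i < m, j < 2) (if j == 0 then 1 else h i).

Definition first_obs (n : nat) : 'I_n -> 'I_n.+1 := widen_ord (leqnSn n).

(* [invmx] is a genuine inverse only when A^T A is invertible; for
   [design_mx h] this means that [h] takes at least two distinct values. *)
Definition ols (R : realType) (m p : nat) (A : 'M[R]_(m, p)) (y : 'cV[R]_m) :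
    'cV[R]_p :=
  invmx (A^T *m A) *m A^T *m y.

Definition ols_estimator (R : realType) (T : Type) (m p : nat)
    (A : 'M[R]_(m, p)) (Y : 'I_m -> T -> R) (j : 'I_p) : T -> R :=
  fun x => ols A (\col_(i < m) Y i x) j 0.

Definition ols_cov (R : realType) (m p : nat) (A : 'M[R]_(m, p))
    (S : 'M[R]_m) : 'M[R]_p :=
  invmx (A^T *m A) *m A^T *m S *m A *m invmx (A^T *m A).

(* Observations are numbered from 1 in the definition of h, so that ordinal i
   stands for observation i.+1. *)
Definition alternating_design (R : realType) (m : nat) (b c : R) (i : 'I_m) : R :=
  if odd i.+1 then b else c.

(* Main.v *)
Require Import Defs.
From HB Require Import structures.
From mathcomp Require Import all_boot all_order all_algebra.
From mathcomp Require Import all_classical all_reals all_analysis.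
From mathcomp Require Import ring.

Set Implicit Arguments.
Unset Strict Implicit.
Unset Printing Implicit Defensive.

Import Order.TTheory GRing.Theory Num.Theory.
Local Open Scope ring_scope.

(** A design taking only two values [b] and [c] is a one-way layout with two
    groups.  If [L] is the incidence matrix of the observations in the groups
    and [M] is the 2 x 2 matrix with rows [(1, b)] and [(1, c)], the design
    matrix is [L *m M], and [M] is invertible because [b != c].  The model has
    as many parameters as groups, so the least squares fit goes through the
    two group means: the estimator is [invmx M] applied to the vector of group
    means, for the first [n] observations as for all of them, with the same
    matrix [M].  Means of different groups are uncorrelated, and the mean of a
    group of size [N] has variance [S / N ^ 2], where [S] is the sum of the
    variances in the group; hence ([ols_cov_one_way])
      [V_jj = \sum_k (invmx M)_jk ^ 2 * (S_k / N_k ^ 2)].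
    The last observation changes only one term of this sum, that of its own
    group.  Since its variance [s] is the smallest of all, it is at most the
    average [S / N] in that group, so that
      [(S + s) / (N + 1) ^ 2 <= S / (N * (N + 1)) <= S / N ^ 2],
    which is [mean_variance_recr]; both groups occur among the first [n]
    observations as soon as [1 < n].  The argument works for any number of
    groups and any invertible [M], and [ols_cov_one_way_recr] is stated so.

    That the matrices compared are the covariance matrices of the estimators
    is the bilinearity of covariance on square-integrable functions
    ([covariance_ols]). *)

Section CovarianceOfLinearEstimators.
Variables (R : realType) (d : measure_display) (T : measurableType d).
Variable P : probability T R.

Lemma Lfun2_comb m (F : 'I_m -> T -> R) (a : 'I_m -> R) :
  (forall i, F i \in Lfun P 2%:E) ->
  (fun x => \sum_(i < m) a i * F i x) \in Lfun P 2%:E.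
Proof.
move=> F2; elim: m F a F2 => [|m IHm] F a F2.
  under eq_fun do rewrite big_ord0.
  by rewrite Lfun_cst.
under eq_fun do rewrite big_ord_recl.
have aF0 : (fun x => a ord0 * F ord0 x) \in Lfun P 2%:E.
  under eq_fun do rewrite mulrC.
  by rewrite (@Lfun_scale _ _ _ P (F ord0) (a ord0) 2)// ler1n.
rewrite -[X in X \in _]/((fun x => a ord0 * F ord0 x) \+
  (fun x => \sum_(i < m) a (lift ord0 i) * F (lift ord0 i) x)).
apply: rpredD => // [|?]; first by rewrite lee1n.
exact: (IHm (fun i => F (lift ord0 i)) (fun i => a (lift ord0 i))).
Qed.

Lemma covariance_combl m (F : 'I_m -> T -> R) (a : 'I_m -> R) (Z : T -> R) :
  (forall i, F i \in Lfun P 2%:E) -> Z \in Lfun P 2%:E ->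
  covariance P (fun x => \sum_(i < m) a i * F i x) Z =
    (\sum_(i < m) (a i)%:E * covariance P (F i) Z)%E.
Proof.
move=> F2 Z2; elim: m F a F2 => [|m IHm] F a F2.
  under eq_fun do rewrite big_ord0.
  by rewrite big_ord0 (covariance_cst_l P 0).
have Pfin : P setT \is a fin_num := fin_num_measure P _ measurableT.
have aF0 : (fun x => a ord0 * F ord0 x) = a ord0 \o* F ord0.
  by apply/funext => x /=; rewrite mulrC.
under eq_fun do rewrite big_ord_recl.
rewrite -[X in covariance P X]/((fun x => a ord0 * F ord0 x) \+
  (fun x => \sum_(i < m) a (lift ord0 i) * F (lift ord0 i) x)).
rewrite covarianceDl ?Lfun2_comb// ?aF0 ?Lfun_scale ?ler1n//.
by rewrite IHm// covarianceZl ?Lfun2_mul_Lfun1 ?Lfun_subset12// big_ord_recl.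
Qed.

Lemma covariance_comb m (F : 'I_m -> T -> R) (S : 'M[R]_m) (a b : 'I_m -> R) :
  (forall i, F i \in Lfun P 2%:E) ->
  (forall i i', covariance P (F i) (F i') = (S i i')%:E) ->
  covariance P (fun x => \sum_(i < m) a i * F i x)
               (fun x => \sum_(i < m) b i * F i x) =
    (\sum_(i < m) \sum_(i' < m) a i * S i i' * b i')%:E.
Proof.
move=> F2 FS; rewrite covariance_combl ?Lfun2_comb// -sumEFin.
apply: eq_bigr => i _; rewrite covarianceC covariance_combl//.
under eq_bigr do rewrite covarianceC FS -EFinM.
rewrite sumEFin -EFinM mulr_sumr; congr (_%:E).
by apply: eq_bigr => i' _; rewrite -mulrA (mulrC (b i')).
Qed.

(** The estimator is [W *m Y] with [W = (A^T A)^-1 A^T], so its covariance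
    matrix is [W *m S *m W^T]; as the Gram matrix is symmetric, so is its
    inverse, and this is the sandwich formula of [ols_cov]. *)
Lemma covariance_ols m p (A : 'M[R]_(m, p)) (Y : 'I_m -> T -> R) (S : 'M[R]_m)
    (j k : 'I_p) :
  (forall i, Y i \in Lfun P 2%:E) ->
  (forall i i', covariance P (Y i) (Y i') = (S i i')%:E) ->
  covariance P (ols_estimator A Y j) (ols_estimator A Y k) =
    (ols_cov A S j k)%:E.
Proof.
move=> Y2 YS; set W := invmx (A^T *m A) *m A^T.
have olsE l : ols_estimator A Y l = fun x => \sum_(i < m) W l i * Y i x.
  apply/funext => x; rewrite /ols_estimator /ols -/W mxE.
  by apply: eq_bigr => i _; rewrite [X in _ * X]mxE.
have WT : W^T = A *m invmx (A^T *m A).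
  by rewrite trmx_mul trmx_inv trmx_mul !trmxK.
rewrite !olsE (covariance_comb _ _ Y2 YS); congr (_%:E).
rewrite /ols_cov -mulmxA -WT -/W mxE exchange_big/=.
apply: eq_bigr => i _; rewrite !mxE mulr_suml.
by apply: eq_bigr.
Qed.

End CovarianceOfLinearEstimators.

Section OneWayLayout.
Variable R : realType.

Definition incidence_mx m p (g : 'I_m -> 'I_p) : 'M[R]_(m, p) :=
  \matrix_(i < m, k < p) (g i == k)%:R.

Definition group_sum m p (g : 'I_m -> 'I_p) (v : 'I_m -> R) (k : 'I_p) : R :=
  \sum_(i < m | g i == k) v i.

Definition group_size m p (g : 'I_m -> 'I_p) (k : 'I_p) : R :=
  group_sum g (fun=> 1) k.

Lemma incidence_mx_diag m p (g : 'I_m -> 'I_p) (v : 'I_m -> R) :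
  (incidence_mx g)^T *m diag_mx (\row_i v i) *m incidence_mx g =
    diag_mx (\row_k group_sum g v k).
Proof.
apply/matrixP => k l; rewrite mul_mx_diag !mxE /group_sum -sumrMnl.
rewrite [RHS]big_mkcond/=.
apply: eq_bigr => i _; rewrite !mxE.
by have [<-|] := eqVneq (g i) k; rewrite ?mul0r// mul1r mulr_natr.
Qed.

Lemma incidence_mx_gram m p (g : 'I_m -> 'I_p) :
  (incidence_mx g)^T *m incidence_mx g = diag_mx (\row_k group_size g k).
Proof.
rewrite -incidence_mx_diag; congr (_ *m _).
have -> : (\row_(i < m) 1) = const_mx 1 :> 'rV[R]_m.
  by apply/rowP => i; rewrite !mxE.
by rewrite diag_const_mx mulmx1.
Qed.

(** Inverting the Gram matrix [M^T *m D *m M], where [D] is the diagonal matrix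
    of the group sizes, splits the estimator into group means, with covariance
    matrix [diag (S_k / N_k ^ 2)], followed by [invmx M].  The diagonal entries
    involve only squares of entries of [invmx M], hence nonnegative weights
    that depend neither on the observations nor on their number. *)
Lemma ols_cov_one_way m p (g : 'I_m -> 'I_p) (M : 'M[R]_p) (v : 'I_m -> R) :
  M \in unitmx -> (forall k, group_size g k != 0) ->
  forall j, ols_cov (incidence_mx g *m M) (diag_mx (\row_i v i)) j j =
    \sum_k invmx M j k ^+ 2 * (group_sum g v k / group_size g k ^+ 2).
Proof.
move=> M_unit N_neq0 j.
set L := incidence_mx g; set D := diag_mx (\row_k group_size g k).
set D' := diag_mx (\row_k (group_size g k)^-1).
have DD' : D *m D' = 1%:M.
  rewrite mulmx_diag -diag_const_mx; congr diag_mx.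
  by apply/rowP => k; rewrite !mxE mulfV.
have invG : invmx ((L *m M)^T *m (L *m M)) = invmx M *m D' *m (invmx M)^T.
  have -> : (L *m M)^T *m (L *m M) = M^T *m (D *m M).
    by rewrite trmx_mul -mulmxA (mulmxA L^T) incidence_mx_gram.
  have GG' : M^T *m (D *m M) *m (invmx M *m D' *m (invmx M)^T) = 1%:M.
    rewrite -!mulmxA (mulmxA M) mulmxV// mul1mx (mulmxA D) DD' mul1mx.
    by rewrite -trmx_mul mulVmx// trmx1.
  have [G_unit _] := mulmx1_unit GG'.
  by rewrite -[LHS]mulmx1 -GG' mulKmx.
rewrite /ols_cov invG trmx_mul.
have -> : invmx M *m D' *m (invmx M)^T *m (M^T *m L^T) *m
    diag_mx (\row_i v i) *m (L *m M) *m (invmx M *m D' *m (invmx M)^T) =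
  invmx M *m diag_mx (\row_k (group_sum g v k / group_size g k ^+ 2)) *m
    (invmx M)^T.
  (* M cancels on both sides of the middle factor, leaving D^-1 (L^T S L) D^-1 *)
  rewrite -!mulmxA (mulmxA M) mulmxV// mul1mx.
  rewrite (mulmxA (invmx M)^T) -trmx_mul mulmxV// trmx1 mul1mx.
  congr (_ *m _); rewrite !mulmxA; congr (_ *m _).
  rewrite -2!(mulmxA D') incidence_mx_diag mulmx_diag mulmx_diag.
  congr diag_mx; apply/rowP => k; rewrite !mxE.
  by rewrite mulrAC -invfM -expr2 mulrC.
rewrite mul_mx_diag mxE; apply: eq_bigr => k _; rewrite !mxE.
by rewrite mulrAC -expr2.
Qed.

Lemma group_sum_recr n p (g : 'I_n.+1 -> 'I_p) (v : 'I_n.+1 -> R) (k : 'I_p) :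
  group_sum g v k = group_sum (g \o @first_obs n) (v \o @first_obs n) k
    + (if g ord_max == k then v ord_max else 0).
Proof.
rewrite /group_sum [LHS]big_mkcond big_ord_recr/=; congr (_ + _).
by rewrite [RHS]big_mkcond.
Qed.

(** A new observation whose variance is at most the average variance of its
    group decreases the variance of the group mean.  Cleared of denominators,
    with [N * s <= S]:
      [(S + s) * N ^ 2 <= S * N ^ 2 + S * N <= S * (N + 1) ^ 2]. *)
Lemma mean_variance_recr n p (g : 'I_n.+1 -> 'I_p) (v : 'I_n.+1 -> R) :
  (forall i, 0 <= v i) -> (forall i, v ord_max <= v i) ->
  forall k, 0 < group_size (g \o @first_obs n) k ->
  group_sum g v k / group_size g k ^+ 2 <=
    group_sum (g \o @first_obs n) (v \o @first_obs n) k
      / group_size (g \o @first_obs n) k ^+ 2.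
Proof.
move=> v_ge0 v_min k; rewrite (group_sum_recr g v).
have -> : group_size g k = group_size (g \o @first_obs n) k
    + (if g ord_max == k then 1 else 0) by exact: group_sum_recr.
set N := group_size _ k; set S := group_sum _ _ k => N_gt0.
case: ifP => _; last by rewrite !addr0.
have S_ge0 : 0 <= S by apply: sumr_ge0 => i _; exact: v_ge0.
have NS : N * v ord_max <= S.
  rewrite /N /group_size /group_sum mulr_suml; apply: ler_sum => i _.
  by rewrite mul1r; exact: v_min.
have N1_gt0 : 0 < N + 1 by rewrite addr_gt0.
rewrite ler_pdivrMr ?exprn_gt0// mulrAC ler_pdivlMr ?exprn_gt0//.
have h1 : (N * v ord_max) * N <= S * N by rewrite ler_pM2r.
have h2 : 0 <= S * N by rewrite mulr_ge0// ltW.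
have -> : (S + v ord_max) * N ^+ 2 = S * N ^+ 2 + N * v ord_max * N by ring.
have -> : S * (N + 1) ^+ 2 = S * N ^+ 2 + S * N + (S * N + S) by ring.
by rewrite -[leLHS]addr0 lerD ?lerD ?addr_ge0.
Qed.

(** Each group must be observed before the last observation, as otherwise the
    estimator based on the first [n] observations does not exist. *)
Lemma ols_cov_one_way_recr n p (g : 'I_n.+1 -> 'I_p) (M : 'M[R]_p)
    (v : 'I_n.+1 -> R) :
  M \in unitmx ->
  (forall i, 0 <= v i) -> (forall i, v ord_max <= v i) ->
  (forall k, exists i, g (@first_obs n i) = k) ->
  let A := incidence_mx g *m M in
  forall j, ols_cov A (diag_mx (\row_i v i)) j j <=
    ols_cov (rowsub (@first_obs n) A) (diag_mx (\row_i v (@first_obs n i))) j j.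
Proof.
move=> M_unit v_ge0 v_min g_surj A j.
have N0_gt0 k : 0 < group_size (g \o @first_obs n) k.
  have [i gi] := g_surj k; rewrite /group_size /group_sum.
  by rewrite (bigD1 i) /= ?gi// ltr_pwDl// sumr_ge0.
have N1_gt0 k : 0 < group_size g k.
  rewrite /group_size group_sum_recr; apply: ltr_wpDr (N0_gt0 k).
  by case: ifP.
have -> : rowsub (@first_obs n) A = incidence_mx (g \o @first_obs n) *m M.
  rewrite -mul_rowsub_mx; congr (_ *m _).
  by apply/matrixP => i k; rewrite !mxE.
rewrite !ols_cov_one_way// => [|k|k]; try by rewrite gt_eqF.
apply: ler_sum => k _; apply: ler_wpM2l; first exact: sqr_ge0.
exact: mean_variance_recr.
Qed.

End OneWayLayout.

Section AlternatingDesign.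
Variable R : realType.

(** The value [b] is taken at the odd observations, that is at the even
    ordinals, since the ordinal [i] stands for observation [i.+1]. *)
Definition parity_group m (i : 'I_m) : 'I_2 := if odd i then 1 else 0.

Definition two_point_mx (b c : R) : 'M[R]_2 :=
  \matrix_(k, j) (if j == 0 then 1 else if k == 0 then b else c).

Lemma two_point_mx_unit (b c : R) : b != c -> two_point_mx b c \in unitmx.
Proof.
move=> bc; rewrite unitmxE unitfE (expand_det_row _ ord0).
rewrite !big_ord_recl big_ord0 /cofactor !det_mx11 !mxE/=.
by rewrite addr0 expr0 expr1 !mul1r mulN1r mulrN mulr1 subr_eq0 eq_sym.
Qed.

Lemma design_mx_alternating m (b c : R) :
  design_mx (@alternating_design R m b c) =
    incidence_mx R (@parity_group m) *m two_point_mx b c.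
Proof.
apply/matrixP => i j; rewrite !mxE !big_ord_recl big_ord0 !mxE.
rewrite /alternating_design /parity_group/=.
by case: (odd i); case: ifP => _ /=; rewrite ?mul1r ?mul0r ?addr0 ?add0r.
Qed.

End AlternatingDesign.

Theorem theorem4 (R : realType) (d : measure_display) (T : measurableType d)
    (P : probability T R) (n : nat) (beta1 beta2 b c : R)
    (Y eps : 'I_n.+1 -> {RV P >-> R}) (sigma : 'I_n.+1 -> R) :
  (1 < n)%N ->
  b != c ->
  let h : 'I_n.+1 -> R := alternating_design b c in
  (forall i x, Y i x = beta1 + beta2 * h i + eps i x) ->
  (forall i, (Y i : T -> R) \in Lfun P 2%:E) ->
  (forall i, 'E_P[eps i] = 0)%E ->
  (forall i j, i != j -> covariance P (Y i) (Y j) = 0%E) ->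
  (forall i, 'V_P[Y i] = (sigma i ^+ 2)%:E) ->
  (forall i j : 'I_n.+1, (i <= j)%N -> sigma j ^+ 2 <= sigma i ^+ 2) ->
  let A1 := design_mx h in
  let A0 := rowsub (@first_obs n) A1 in
  let Sigma11 := diag_mx (\row_(i < n.+1) sigma i ^+ 2) in
  let Sigma00 := diag_mx (\row_(i < n) sigma (first_obs i) ^+ 2) in
  let V11 := ols_cov A1 Sigma11 in
  let V00 := ols_cov A0 Sigma00 in
  let betahat1 := ols_estimator A1 (fun i => Y i : T -> R) in
  let betahat0 := ols_estimator A0 (fun i => Y (first_obs i) : T -> R) in
  [/\ forall j k, covariance P (betahat0 j) (betahat0 k) = (V00 j k)%:E,
      forall j k, covariance P (betahat1 j) (betahat1 k) = (V11 j k)%:E &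
      forall i, V11 i i <= V00 i i].
Proof.
move=> n_gt1 bc h _ Y2 _ Y_uncorr Y_var sigma_mono A1 A0 Sigma11 Sigma00 V11 V00
  betahat1 betahat0.
have Ycov i i' : covariance P (Y i) (Y i') = (Sigma11 i i')%:E.
  rewrite !mxE; have [<-|ii'] := eqVneq i i'; first by rewrite mulr1n -Y_var.
  by rewrite mulr0n Y_uncorr.
split.
- move=> j k; apply: covariance_ols => [i|i i']; first exact: Y2.
  by rewrite Ycov !mxE.
- by move=> j k; apply: covariance_ols.
- move=> j; rewrite /V11 /V00 /A0 /A1 /h design_mx_alternating.
  apply: (@ols_cov_one_way_recr _ _ _ _ _ (fun i => sigma i ^+ 2)).
  + exact: two_point_mx_unit.
  + by move=> i; exact: sqr_ge0.
  + by move=> i; apply: sigma_mono; rewrite -ltnS ltn_ord.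
  (* observations 1 and 2 already meet both groups *)
  + move=> k; exists (Ordinal (leq_trans (ltn_ord k) n_gt1)).
    by apply/val_inj; case: k => -[|[|[]]].
Qed.
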